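(* Let $p\in[1,\infty]$, and let $E$ be a locally convex space. (i) Every precompact subset $A$ of $E$ is $(p,\infty)$-$\mathcal{E}$-limited. (ii) If $E$ is $p$-barrelled, then every precompact subset $A$ of $E$ is $(p,\infty)$-limited.
   Context: All locally convex spaces are Hausdorff, over $\mathbb{F}\in\{\mathbb{R},\mathbb{C}\}$; subsets $A$ are non-empty; $\omega=\{0,1,2,\dots\}$. $E'$ is the topological dual of $E$. A subset $A$ of $E$ is precompact if for every neighborhood $U$ of zero there is a finite set $F\subseteq E$ with $A\subseteq F+U$. A sequence $\{\chi_n\}_{n\in\omega}$ in $E'$ is weak$^\ast$ $p$-summable if $(\langle\chi_n,x\rangle)_n\in\ell_p$ (or $\in c_0$ if $p=\infty$) for every $x\in E$. $E$ is $p$-barrelled if every weak$^\ast$ $p$-summable sequence in $E'$ is equicontinuous. With $\|\chi\|_A:=\sup\{|\chi(x)|:x\in A\cup\{0\}\}$, a non-empty subset $A$ of $E$ is $(p,\infty)$-limited (resp., $(p,\infty)$-$\mathcal{E}$-limited) if $\|\chi_n\|_A\to0$ for every (resp., every equicontinuous) weak$^\ast$ $p$-summable sequence $\{\chi_n\}$ in $E'$. *)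

(* Defs.v *)
From mathcomp Require Import all_boot all_order all_algebra.
From mathcomp Require Import all_classical all_reals all_analysis.
From mathcomp Require Import complex.

Set Implicit Arguments.
Unset Strict Implicit.
Unset Printing Implicit Defensive.

Import Order.TTheory GRing.Theory Num.Theory.
Import numFieldNormedType.Exports.

Local Open Scope classical_set_scope.
Local Open Scope ring_scope.

Variant scalar_kind := RealScalars | ComplexScalars.

Definition scalar_field (R : realType) (k : scalar_kind) : numFieldType :=
  match k with RealScalars => R | ComplexScalars => R[i] end.

(** The norm of a [numFieldType] takes its values in the field itself; this is
    the same absolute value, seen as an element of [R]. *)
Definition modulus (R : realType) (k : scalar_kind) : scalar_field R k -> R :=
  match k with
  | RealScalars => fun x : R => `|x|
  | ComplexScalars => fun z : R[i] => complex.Re `|z|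
  end.

(** Membership in l_p for finite p, and in c_0 (not l_oo) for p = +oo. *)
Definition p_summable (R : realType) (k : scalar_kind) (p : \bar R)
    (u : nat -> scalar_field R k) : Prop :=
  match p with
  | r%:E => (\sum_(0 <= n <oo) (modulus (u n) `^ r)%:E < +oo)%E
  | +oo%E => modulus (u n) @[n --> \oo] --> (0 : R)
  | -oo%E => False
  end.

Section LocallyConvex.
Context (R : realType) (k : scalar_kind) (E : tvsType (scalar_field R k)).

Record tdual := TDual {
  tdual_fun :> {linear E -> (scalar_field R k)^o};
  tdual_continuous : continuous tdual_fun
}.

(** Not [compact.precompact], which means relatively compact. *)
Definition tvs_precompact (A : set E) : Prop :=
  forall U : set E, nbhs 0 U ->
    exists2 F : set E, finite_set F & A `<=` [set x + u | x in F & u in U].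

Definition weakstar_p_summable (p : \bar R) (chi : nat -> tdual) : Prop :=
  forall x : E, p_summable p (fun n => chi n x).

Definition equicontinuous_seq (chi : nat -> tdual) : Prop :=
  equicontinuous [set: nat] (fun n => chi n : E -> (scalar_field R k)^o).

Definition p_barrelled (p : \bar R) : Prop :=
  forall chi : nat -> tdual, weakstar_p_summable p chi -> equicontinuous_seq chi.

(** Extended-real valued, since [A] may be unbounded. *)
Definition dual_seminorm (A : set E) (chi : tdual) : \bar R :=
  ereal_sup [set (modulus (chi x))%:E | x in A `|` [set 0]].

Definition p_limited (p : \bar R) (A : set E) : Prop :=
  forall chi : nat -> tdual, weakstar_p_summable p chi ->
    dual_seminorm A (chi n) @[n --> \oo] --> 0%E.

Definition p_E_limited (p : \bar R) (A : set E) : Prop :=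
  forall chi : nat -> tdual, equicontinuous_seq chi ->
    weakstar_p_summable p chi ->
    dual_seminorm A (chi n) @[n --> \oo] --> 0%E.

End LocallyConvex.

Arguments p_barrelled {R k} E p.

(* Main.v *)
Require Import Defs.
From mathcomp Require Import all_boot all_order all_algebra.
From mathcomp Require Import all_classical all_reals all_analysis.
From mathcomp Require Import complex.

Import Order.TTheory GRing.Theory Num.Theory.
Import numFieldNormedType.Exports.

Local Open Scope classical_set_scope.
Local Open Scope ring_scope.

(** Over a precompact set, equicontinuity turns pointwise convergence to zero
    into uniform convergence, and weak* p-summability is used only through the
    pointwise convergence it implies.

    Let [chi] be equicontinuous with [chi n x] tending to 0 for every [x], and
    let [e > 0].  Equicontinuity at 0 gives a neighbourhood [U] of 0 on which
    all the [chi n] are smaller than [e / 2] ([equicontinuous_small_near0]).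
    Precompactness covers [A] by [F + U] with [F] finite, and finitely many
    sequences tending to 0 are eventually smaller than [e / 2] simultaneously,
    so that [|chi n| <= e / 2 + e / 2] on [A] for all large [n]
    ([equicontinuous_cvg0_uniform]).

    Pointwise convergence is [p_summable_cvg0]: it is the definition for
    [p = +oo], and for finite [p] the terms of a convergent series tend to 0.
    In a [p]-barrelled space equicontinuity comes for free, whence the second
    claim. *)

Lemma modulusD (R : realType) (k : scalar_kind) (x y : scalar_field R k) :
  modulus (x + y) <= modulus x + modulus y.
Proof.
case: k x y => x y /=; first exact: ler_normD.
by have := ler_normD x y; rewrite lecE raddfD => /andP[].
Qed.

Lemma modulus_ge0 (R : realType) (k : scalar_kind) (x : scalar_field R k) :
  0 <= modulus x.
Proof.
case: k x => x //=.
by have := normr_ge0 x; rewrite lecE => /andP[].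
Qed.

Lemma modulus0 (R : realType) (k : scalar_kind) :
  modulus (0 : scalar_field R k) = 0.
Proof.
case: k; first exact: normr0.
exact: (congr1 (@complex.Re R) (normr0 R[i])).
Qed.

(** Links the two absolute values: radii of balls live in the scalar field,
    whereas bounds on the modulus are real. *)
Lemma modulus_lt_norm_lt (R : realType) (k : scalar_kind) (e : R) :
  0 < e -> exists2 d : scalar_field R k, 0 < d &
    forall z, `|z| < d -> modulus z < e.
Proof.
case: k => e0; first by exists e.
exists (e%:C)%C; first by rewrite ltcR.
by move=> z; rewrite ltcE => /andP[].
Qed.

Lemma nneseries_lty_cvg0 (R : realType) (u : nat -> \bar R) :
  (forall n, 0 <= u n)%E -> (\sum_(0 <= n <oo) u n < +oo)%E ->
  u n @[n --> \oo] --> 0%E.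
Proof.
move=> u0 uoo.
apply: (squeeze_cvge _ (cvg_cst 0%E) (nneseries_tail_cvg uoo (fun n _ => u0 n))).
apply: nearW => n; rewrite u0 /=.
have <- : (\sum_(n <= i < n.+1) u i = u n)%E by rewrite big_nat1.
by apply: nneseries_lim_ge.
Qed.

Lemma p_summable_cvg0 (R : realType) (k : scalar_kind) (p : \bar R)
    (u : nat -> scalar_field R k) :
  (1 <= p)%E -> p_summable p u -> modulus (u n) @[n --> \oo] --> (0 : R).
Proof.
case: p => [r||] //= r1 su.
have r0 : 0 < r by rewrite (lt_le_trans ltr01) // -lee_fin.
have /fine_cvgP[_ /cvgrPdist_lt cu] :=
  nneseries_lty_cvg0 R (fun n => (modulus (u n) `^ r)%:E)
    (fun n => powR_ge0 (modulus (u n)) r) su.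
apply/cvgrPdist_lt => e e0.
have := cu (e `^ r) (powR_gt0 _ e0); apply: filterS => n /=.
rewrite !sub0r !normrN !ger0_norm ?powR_ge0 ?modulus_ge0 //.
apply: contraTT; rewrite -!leNgt => le_e.
by apply: ge0_ler_powR; rewrite ?nnegrE ?modulus_ge0 ?(ltW e0) ?(ltW r0).
Qed.

Lemma cvge0_nonneg (R : realType) (u : nat -> \bar R) :
  (forall n, 0 <= u n)%E ->
  (forall e : R, 0 < e -> \forall n \near \oo, (u n <= e%:E)%E) ->
  u n @[n --> \oo] --> 0%E.
Proof.
move=> u0 ue; apply/fine_cvgP; split.
  apply: filterS (ue 1 ltr01) => n un1.
  by rewrite ge0_fin_numE // (le_lt_trans un1) // ltry.
apply/cvgrPdist_le => e e0; apply: filterS (ue e e0) => n une /=.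
rewrite sub0r normrN ger0_norm ?fine_ge0 // -lee_fin fineK //.
by rewrite ge0_fin_numE // (le_lt_trans une) // ltry.
Qed.

Section Dual.
Context (R : realType) (k : scalar_kind) (E : tvsType (scalar_field R k)).
Implicit Types (chi : nat -> tdual E) (A : set E).

Lemma equicontinuous_small_near0 chi (e : R) :
  equicontinuous_seq chi -> 0 < e ->
  \forall x \near (0 : E), forall n, modulus (chi n x) < e.
Proof.
move=> chi_eq e0; have [d d0 dP] := modulus_lt_norm_lt R k e e0.
have := chi_eq 0 _ (entourage_ball _ (PosNum d0)).
apply: filterS => x chix n; apply: dP.
have := chix n I.
by rewrite /= linear0 -ball_normE /= sub0r normrN.
Qed.

Lemma equicontinuous_cvg0_uniform chi A (e : R) :
  equicontinuous_seq chi ->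
  (forall x, modulus (chi n x) @[n --> \oo] --> (0 : R)) ->
  tvs_precompact A -> 0 < e ->
  \forall n \near \oo, forall x, A x -> modulus (chi n x) <= e.
Proof.
move=> chi_eq chi0 pA e0; have e20 : 0 < e / 2 by rewrite divr_gt0.
have [F finF AF] := pA _ (equicontinuous_small_near0 _ _ chi_eq e20).
have smallF : \forall n \near \oo,
    (\bigcap_(x in F) [set m | modulus (chi m x) < e / 2]) n.
  rewrite -(fset_setK finF).
  apply: filter_bigI => x _.
  move/cvgrPdist_lt: (chi0 x) => /(_ _ e20); apply: filterS => n.
  by rewrite /= sub0r normrN ger0_norm ?modulus_ge0.
apply: filterS smallF => n Fn _ /AF[x Fx [y Uy] <-].
rewrite linearD (le_trans (modulusD _ _ _ _)) // [e in leRHS]splitr.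
by apply: lerD; [exact: ltW (Fn _ Fx) | exact: ltW (Uy n)].
Qed.

(** The point 0 adjoined to [A] in the supremum keeps the seminorm nonnegative,
    so that upper bounds suffice for convergence to 0; linear forms vanish
    there, so it does not affect those bounds. *)
Lemma precompact_p_E_limited (p : \bar R) A :
  (1 <= p)%E -> tvs_precompact A -> p_E_limited p A.
Proof.
move=> p1 pA chi chi_eq chi_sum; apply: cvge0_nonneg => [n|e e0].
  apply: (@ereal_sup_ubound _ _ 0%E); exists 0; first by right.
  by rewrite linear0 modulus0.
have chi0 x := p_summable_cvg0 _ _ _ _ p1 (chi_sum x).
apply: filterS (equicontinuous_cvg0_uniform _ _ _ chi_eq chi0 pA e0) => n le_e.
apply: ge_ereal_sup => _ [x [Ax|->] <-]; rewrite lee_fin; first exact: le_e.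
by rewrite linear0 modulus0 ltW.
Qed.

End Dual.

Theorem proposition3p6 (R : realType) (k : scalar_kind)
    (E : tvsType (scalar_field R k)) (p : \bar R)
    (hausdorffE : hausdorff_space E) (p_ge1 : (1 <= p)%E) :
  (forall A : set E, A !=set0 -> tvs_precompact A -> p_E_limited p A) /\
  (p_barrelled E p ->
   forall A : set E, A !=set0 -> tvs_precompact A -> p_limited p A).
Proof.
split=> [A _ pA|barE A _ pA chi chi_sum]; first exact: precompact_p_E_limited.
exact: precompact_p_E_limited (barE _ chi_sum) chi_sum.
Qed.
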